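(* Not all singular foliations arise from Lie algebroids. That is, there exist a smooth manifold $M$ and a singular foliation $\mathcal F$ on $M$ such that there is no Lie algebroid $A\to M$ with anchor $\rho:A\to TM$ satisfying $\mathcal F=\{\rho(a): a\in C_c^\infty(M;A)\}$.
   Context: Let $\mathfrak X_c(M)$ be the $C^\infty(M)$-module of compactly supported smooth vector fields on $M$. A (singular) foliation on $M$ is a $C^\infty(M)$-submodule $\mathcal F\subseteq\mathfrak X_c(M)$ stable under the Lie bracket and locally finitely generated: every point of $M$ has an open neighborhood $U$ and finitely many $X_1,\dots,X_n\in\mathfrak X(M)$ with $\mathcal F_U=\sum_iC_c^\infty(U)X_i|_U$, where $\mathcal F_U$ is the submodule of $\mathfrak X_c(U)$ generated by $fX|_U$ with $f\in C_c^\infty(U)$, $X\in\mathcal F$. Here $C_c^\infty(M;A)$ denotes the compactly supported smooth sections of $A$. Any Lie algebroid $A\to M$ (of finite rank) gives rise to the singular foliation $\{\rho(a):a\in C_c^\infty(M;A)\}$. *)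

(* Defs.v *)
From HB Require Import structures.
From mathcomp Require Import all_boot all_order all_algebra.
From mathcomp Require Import all_classical all_reals all_analysis.
Import Order.TTheory GRing.Theory Num.Theory.
Import numFieldNormedType.Exports.

Set Implicit Arguments.
Unset Strict Implicit.
Unset Printing Implicit Defensive.

Local Open Scope classical_set_scope.
Local Open Scope ring_scope.

(* Conventions.
   - Objects living on an open set U are represented by total functions; only
     their values on U matter, since the predicates below only inspect U.
   - Compactly supported objects on U are identified with their extension by
     zero, i.e. with objects on M having compact support contained in U.
     Accordingly X_c(U) and C_c^oo(U) are sets of total functions on M, and
     the restriction to U of something supported in U is that same thing. *)

(* C^k on an open set U of R^n: all partial derivatives of order <= k exist
   and are continuous on U. *)
Fixpoint Ck (R : realType) (n k : nat) (U : set 'rV[R]_n)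
    (f : 'rV[R]_n -> R) : Prop :=
  (forall x, U x -> {for x, continuous f}) /\
  if k is k'.+1 then
    forall i : 'I_n,
      (forall x, U x -> derivable f x (delta_mx 0 i)) /\
      Ck k' U (fun x => 'D_(delta_mx 0 i) f x)
  else True.

Definition Cinf (R : realType) (n : nat) (U : set 'rV[R]_n)
    (f : 'rV[R]_n -> R) : Prop :=
  forall k, Ck k U f.

Record chart (R : realType) (T : topologicalType) (n : nat) := Chart {
  cdom : set T;
  cmap : T -> 'rV[R]_n;
  cinv : 'rV[R]_n -> T;
  cdom_open : open cdom;
  cimg_open : open (cmap @` cdom);
  cmapK : forall x, cdom x -> cinv (cmap x) = x;
  cmap_cont : forall x, cdom x -> {for x, continuous cmap};
  cinv_cont : forall y, (cmap @` cdom) y -> {for y, continuous cinv}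
}.

(* The atlas is not required to be maximal.  [chart_at] selects a preferred
   chart around each point; it is used to identify T_xM with R^n. *)
Record manifold (R : realType) := Manifold {
  mcarrier :> topologicalType;
  mdim : nat;
  m_hausdorff : hausdorff_space mcarrier;
  m_second_countable : @second_countable mcarrier;
  cidx : Type;
  atlas : cidx -> chart R mcarrier mdim;
  chart_at : mcarrier -> cidx;
  chart_atP : forall x, cdom (atlas (chart_at x)) x;
  atlas_compat : forall (i j : cidx) (l : 'I_mdim),
    Cinf (cmap (atlas i) @` (cdom (atlas i) `&` cdom (atlas j)))
      (fun y => cmap (atlas j) (cinv (atlas i) y) 0 l)
}.

Definition smooth_on (R : realType) (M : manifold R) (U : set M)
    (f : M -> R) : Prop :=
  forall i : cidx M,
    Cinf (cmap (atlas i) @` (U `&` cdom (atlas i)))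
      (fun y => f (cinv (atlas i) y)).

(* C_c^oo(U) *)
Definition Cc (R : realType) (M : manifold R) (U : set M) (f : M -> R) : Prop :=
  [/\ smooth_on setT f, compact (closure [set x | f x != 0])
    & closure [set x | f x != 0] `<=` U].

(* A tangent vector at x is given by its components in the preferred chart at
   x; its components in another chart around x are obtained by applying the
   derivative of the transition map, see [tcoord]. *)
Definition tangent (R : realType) (M : manifold R) (x : M) : lmodType R :=
  'rV[R]_(mdim M).

Definition tcoord (R : realType) (M : manifold R) (i : cidx M) (x : M)
    (v : tangent x) : 'rV[R]_(mdim M) :=
  let c := atlas (chart_at x) in
  'D_(v : 'rV[R]_(mdim M)) (fun y => cmap (atlas i) (cinv c y)) (cmap c x).

Definition vfield (R : realType) (M : manifold R) : Type :=
  forall x : M, tangent x.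

(* The expression of X in the chart i, as a map R^n -> R^n. *)
Definition local_rep (R : realType) (M : manifold R) (i : cidx M)
    (X : vfield M) (y : 'rV[R]_(mdim M)) : 'rV[R]_(mdim M) :=
  tcoord i (X (cinv (atlas i) y)).

Definition smooth_vf_on (R : realType) (M : manifold R) (U : set M)
    (X : vfield M) : Prop :=
  forall (i : cidx M) (l : 'I_(mdim M)),
    Cinf (cmap (atlas i) @` (U `&` cdom (atlas i)))
      (fun y => local_rep i X y 0 l).

(* v(f), for v in T_xM and f a smooth function near x *)
Definition tderiv (R : realType) (M : manifold R) (f : M -> R) (x : M)
    (v : tangent x) : R :=
  let c := atlas (chart_at x) in
  'D_(v : 'rV[R]_(mdim M)) (fun y => f (cinv c y)) (cmap c x).

(* [X, Y]^l = sum_j X^j d_j Y^l - Y^j d_j X^l, computed at x in the preferred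
   chart at x, in which the components of X x are X x itself. *)
Definition lie_bracket (R : realType) (M : manifold R) (X Y : vfield M) :
    vfield M :=
  fun x =>
    let i := chart_at x in
    let p := cmap (atlas i) x in
    ('D_(X x : 'rV[R]_(mdim M)) (local_rep i Y) p
     - 'D_(Y x : 'rV[R]_(mdim M)) (local_rep i X) p : 'rV[R]_(mdim M)).

(* X_c(U) *)
Definition Xc (R : realType) (M : manifold R) (U : set M) : set (vfield M) :=
  [set X | [/\ smooth_vf_on setT X, compact (closure [set x | X x != 0])
             & closure [set x | X x != 0] `<=` U]].

(* G is a C^oo(U)-submodule of X_c(U).  The values of h outside U are
   irrelevant because X vanishes there. *)
Definition submodule (R : realType) (M : manifold R) (U : set M)
    (G : set (vfield M)) : Prop :=
  [/\ G `<=` Xc U,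
      G (fun x => 0),
      forall X Y, G X -> G Y -> G (fun x => X x + Y x)
    & forall h X, smooth_on U h -> G X -> G (fun x => h x *: X x)].

(* F_U *)
Definition restr_fol (R : realType) (M : manifold R) (F : set (vfield M))
    (U : set M) : set (vfield M) :=
  smallest (submodule U)
    [set Y | exists f X, [/\ Cc U f, F X & Y = (fun x => f x *: X x)]].

Definition locally_fg (R : realType) (M : manifold R) (F : set (vfield M)) :
    Prop :=
  forall x : M, exists U : set M, [/\ open U, U x &
    exists (n : nat) (Xs : 'I_n -> vfield M),
      (forall i, smooth_vf_on setT (Xs i)) /\
      restr_fol F U =
        [set Y | exists2 f : 'I_n -> M -> R, (forall i, Cc U (f i))
                 & Y = (fun y => \sum_i f i y *: Xs i y)]].

Definition singular_foliation (R : realType) (M : manifold R)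
    (F : set (vfield M)) : Prop :=
  [/\ submodule setT F,
      forall X Y, F X -> F Y -> F (lie_bracket X Y)
    & locally_fg F].

(* A smooth vector bundle given by its fibres and a smoothly compatible family
   of local trivializations.  The rank is finite and locally constant; it may
   differ between connected components. *)
Record vbundle (R : realType) (M : manifold R) := VBundle {
  fiber : M -> lmodType R;
  tidx : Type;
  tdom : tidx -> set M;
  trank : tidx -> nat;
  frame : forall (j : tidx) (x : M), {linear 'rV[R]_(trank j) -> fiber x};
  fcoord : forall (j : tidx) (x : M), fiber x -> 'rV[R]_(trank j);
  tdom_open : forall j, open (tdom j);
  tdom_cover : forall x, exists j, tdom j x;
  frameK : forall j x, tdom j x -> cancel (frame j x) (@fcoord j x);
  fcoordK : forall j x, tdom j x -> cancel (@fcoord j x) (frame j x);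
  triv_compat : forall (i j : tidx) (k : 'I_(trank i)) (l : 'I_(trank j)),
    smooth_on (tdom i `&` tdom j)
      (fun x => @fcoord j x (frame i x (delta_mx 0 k)) 0 l)
}.

Definition sect (R : realType) (M : manifold R) (E : vbundle M) : Type :=
  forall x : M, fiber E x.

Definition smooth_sect (R : realType) (M : manifold R) (E : vbundle M)
    (s : sect E) : Prop :=
  forall (j : tidx E) (l : 'I_(trank j)),
    smooth_on (tdom j) (fun x => fcoord j (s x) 0 l).

Record lie_algebroid (R : realType) (M : manifold R) := LieAlgebroid {
  bundle :> vbundle M;
  anchor : forall x : M, {linear fiber bundle x -> tangent x};
  anchor_smooth : forall (j : tidx bundle) (k : 'I_(trank j)),
    smooth_vf_on (tdom j) (fun x => anchor x (frame j x (delta_mx 0 k)));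
  (* only the values on smooth sections are meaningful *)
  abracket : sect bundle -> sect bundle -> sect bundle;
  abracket_smooth : forall a b, smooth_sect a -> smooth_sect b ->
    smooth_sect (abracket a b);
  abracket_linear : forall (r : R) a b c,
    smooth_sect a -> smooth_sect b -> smooth_sect c ->
    abracket (fun x => r *: a x + b x) c
      = (fun x => r *: abracket a c x + abracket b c x);
  abracket_anti : forall a b, smooth_sect a -> smooth_sect b ->
    abracket a b = (fun x => - abracket b a x);
  abracket_jacobi : forall a b c,
    smooth_sect a -> smooth_sect b -> smooth_sect c ->
    forall x, abracket a (abracket b c) x + abracket b (abracket c a) x
      + abracket c (abracket a b) x = 0;
  abracket_leibniz : forall (f : M -> R) a b,
    smooth_on setT f -> smooth_sect a -> smooth_sect b ->
    abracket a (fun x => f x *: b x)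
      = (fun x => f x *: abracket a b x + tderiv f (anchor x (a x)) *: b x);
  (* redundant: follows from the Jacobi identity and the Leibniz rule *)
  anchor_bracket : forall a b, smooth_sect a -> smooth_sect b ->
    (fun x => anchor x (abracket a b x))
      = lie_bracket (fun x => anchor x (a x)) (fun x => anchor x (b x))
}.

(* C_c^oo(M; A) *)
Definition Cc_sect (R : realType) (M : manifold R) (E : vbundle M) :
    set (sect E) :=
  [set a | smooth_sect a /\ compact (closure [set x | a x != 0])].

(* {rho(a) : a in C_c^oo(M; A)} *)
Definition induced_foliation (R : realType) (M : manifold R)
    (A : lie_algebroid M) : set (vfield M) :=
  [set X | exists2 a : sect A, Cc_sect a & X = (fun x => anchor A x (a x))].

(* Main.v *)
Require Import Defs.
From mathcomp Require Import all_boot all_order all_algebra.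
From mathcomp Require Import all_classical all_reals all_analysis.
From mathcomp Require Import ring lra.
Import Order.TTheory GRing.Theory Num.Theory.
Import numFieldNormedType.Exports.

Set Implicit Arguments.
Unset Strict Implicit.
Unset Printing Implicit Defensive.

Local Open Scope classical_set_scope.
Local Open Scope ring_scope.

(** A Lie algebroid A whose anchor image is F generates F near each point by
    finitely many fields, namely the images of a local frame, and the length of
    that frame is the rank of A, which is constant on a connected manifold. So
    it is enough to find, on a connected manifold, a singular foliation whose
    minimal number of local generators is finite at every point but unbounded.

    On the plane, all fields are taken multiples of the first coordinate field
    e0. Let g_0, g_1, ... be smooth functions of which no two are nonzero at
    the same point and such that only finitely many are nonzero on any bounded
    set, and let F consist of the finite sums of the fields h_m g_m e0 with h_m
    smooth and compactly supported. Disjointness kills all mixed terms in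
    a bracket:
      [sum a_m g_m e0, sum b_m g_m e0] = sum g_m^2 (a_m b_m' - b_m a_m') e0,
    so F is involutive, and it is locally finitely generated by the g_m e0
    ([linefol_singular]).

    Suppose that F comes from A and that a point p lies in the closure of
    m sets {g_k != 0}. Near p, the field g_i e0 is (up to a bump function) a
    combination of the frame fields with coefficients c_il, and each frame
    field is in turn a combination of the g_k e0 with coefficients b_lk. On
    {g_k != 0} only g_k survives, so the product of the matrices c and b is
    there a nonzero multiple of the identity column by column, and by continuity
    this holds at p itself. A product through a space whose dimension is the
    rank of A has at most that rank, so m is at most the rank ([rank_bound]).

    The functions g_m are nonzero exactly on open sectors, bounded by two rays
    and a vertical line, with apex (k, 0), where k is the binary logarithm of
    m ([sector]). At least 2 ^ k sectors have apex (k, 0), which exceeds any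
    given rank for large k. *)

(** * Calculus of functions of class C^k *)

Section Calculus.
Context {R : realType} {n : nat}.
Implicit Types (U V : set 'rV[R]_n) (f g : 'rV[R]_n -> R).

Lemma CkS k U f : Ck k.+1 U f -> Ck k U f.
Proof.
elim: k f => [|k IH] f [cf df]; first by split.
split=> // i; have [ddf Df] := df i; split=> //; exact: IH.
Qed.

(** [Ck] is a condition on each point separately, the derivatives being taken
    of the ambient total function. *)
Lemma Ck_union k U V f : Ck k U f -> Ck k V f -> Ck k (U `|` V) f.
Proof.
elim: k f => [|k IH] f [cU dU] [cV dV]; split=> //.
- by move=> x [/cU|/cV].
- by move=> x [/cU|/cV].
- move=> i; have [dU1 dU2] := dU i; have [dV1 dV2] := dV i.
  by split; [move=> x [/dU1|/dV1] | exact: IH].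
Qed.

Lemma Ck_sub k U V f : V `<=` U -> Ck k U f -> Ck k V f.
Proof.
move=> VU; elim: k f => [|k IH] f [cU dU]; split=> //.
- by move=> x /VU /cU.
- by move=> x /VU /cU.
- move=> i; have [dU1 dU2] := dU i.
  by split; [move=> x /VU /dU1 | exact: IH].
Qed.

Lemma Ck_ext k U f g : open U -> (forall x, U x -> f x = g x) ->
  Ck k U f -> Ck k U g.
Proof.
move=> oU; have nU h1 h2 : (forall x, U x -> h1 x = h2 x) ->
    forall x, U x -> {near x, h1 =1 h2}.
  by move=> e x Ux; apply: filterS e _; exact: open_nbhs_nbhs.
have cE h1 h2 : (forall x, U x -> h1 x = h2 x) ->
    (forall x, U x -> {for x, continuous h1}) ->
    forall x, U x -> {for x, continuous (h2 : _ -> R)}.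
  move=> e c x Ux; have := c x Ux.
  rewrite /prop_for /continuous_at (e _ Ux) => /(cvg_trans _); apply.
  apply: (@near_eq_cvg _ _ (nbhs x)); exact: filterS (nU _ _ _ e x Ux).
elim: k f g => [|k IH] f g e [cf df]; split=> //; try exact: cE cf.
move=> i; have [d1 d2] := df i; split.
- by move=> x Ux; exact: near_eq_derivable (nU _ _ _ e x Ux) (d1 x Ux).
- apply: IH d2 => x Ux; apply: near_eq_derive.
  exact: nU.
Qed.

Lemma Ck_cst k U (c : R) : Ck k U (fun=> c).
Proof.
elim: k c => [|k IH] c; split=> //; try by move=> x _; exact: cst_continuous.
move=> i; split; first by move=> x _; exact: derivable_cst.
rewrite (_ : (fun x => 'D_(delta_mx 0 i) (fun=> c) x) = fun=> 0) //.
by apply/funext => x; exact: derive_cst.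
Qed.

Lemma CkD k U f g : open U -> Ck k U f -> Ck k U g ->
  Ck k U (fun x => f x + g x).
Proof.
move=> oU; elim: k f g => [|k IH] f g [cf df] [cg dg]; (split=> //; first by
  move=> x Ux; apply: (@continuousD _ _ _ f g); [exact: cf | exact: cg]).
move=> i; have [df1 df2] := df i; have [dg1 dg2] := dg i; split.
- by move=> x Ux; apply: derivableD; [exact: df1 | exact: dg1].
- apply: Ck_ext (IH _ _ df2 dg2) => // x Ux.
  by rewrite deriveD; [| exact: df1 | exact: dg1].
Qed.

Lemma CkM k U f g : open U -> Ck k U f -> Ck k U g ->
  Ck k U (fun x => f x * g x).
Proof.
move=> oU; elim: k f g => [|k IH] f g Hf Hg; have [cf df] := Hf;
  have [cg dg] := Hg; (split=> //; first by
  move=> x Ux; apply: (@continuousM _ _ f g); [exact: cf | exact: cg]).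
move=> i; have [df1 df2] := df i; have [dg1 dg2] := dg i; split.
- by move=> x Ux; apply: derivableM; [exact: df1 | exact: dg1].
- have := CkD oU (IH _ _ (CkS Hf) dg2) (IH _ _ (CkS Hg) df2).
  apply: Ck_ext => // x Ux.
  by rewrite deriveM; [| exact: df1 | exact: dg1].
Qed.

Lemma CkV k U f : open U -> (forall x, U x -> f x != 0) -> Ck k U f ->
  Ck k U (fun x => (f x)^-1).
Proof.
move=> oU f0; elim: k => [|k IH] Hf; have [cf df] := Hf; (split=> //; first by
  move=> x Ux; apply: continuousV; [exact: f0 | exact: cf]).
move=> i; have [df1 df2] := df i; split.
- by move=> x Ux; apply: derivableV; [exact: f0 | exact: df1].
- have Hi := IH (CkS Hf).
  have := CkM oU (CkM oU (Ck_cst k U (-1)) (CkM oU Hi Hi)) df2.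
  apply: Ck_ext => // x Ux.
  rewrite deriveV; [| exact: f0 | exact: df1].
  by rewrite /GRing.scale /= mulN1r -invfM -expr2.
Qed.

Lemma Cinf_D U f g : open U -> Cinf U f -> Cinf U g ->
  Cinf U (fun x => f x + g x).
Proof. by move=> oU Hf Hg k; apply: CkD. Qed.

Lemma Cinf_M U f g : open U -> Cinf U f -> Cinf U g ->
  Cinf U (fun x => f x * g x).
Proof. by move=> oU Hf Hg k; apply: CkM. Qed.

Lemma Cinf_V U f : open U -> (forall x, U x -> f x != 0) -> Cinf U f ->
  Cinf U (fun x => (f x)^-1).
Proof. by move=> oU f0 Hf k; apply: CkV. Qed.

Lemma Cinf_cst U (c : R) : Cinf U (fun=> c).
Proof. by move=> k; exact: Ck_cst. Qed.

Lemma Cinf_derive U f i : Cinf U f -> Cinf U ('D_(delta_mx 0 i) f).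
Proof. by move=> Hf k; have [_ /(_ i) []] := Hf k.+1. Qed.

Lemma Cinf_derivable U f i x : Cinf U f -> U x -> derivable f x (delta_mx 0 i).
Proof. by move=> Hf; have [_ /(_ i) [H _]] := Hf 1; exact: H. Qed.

Lemma Cinf_continuous U f x : Cinf U f -> U x -> {for x, continuous f}.
Proof. by move=> Hf; have [H _] := Hf 0; exact: H. Qed.

Lemma Cinf_ext U f g : open U -> (forall x, U x -> f x = g x) ->
  Cinf U f -> Cinf U g.
Proof. by move=> oU e Hf k; exact: Ck_ext (Hf k). Qed.

Lemma Cinf_sub U V f : V `<=` U -> Cinf U f -> Cinf V f.
Proof. by move=> VU Hf k; exact: Ck_sub (Hf k). Qed.

Lemma Cinf_union U V f : Cinf U f -> Cinf V f -> Cinf (U `|` V) f.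
Proof. by move=> HU HV k; exact: Ck_union. Qed.

Lemma Cinf_sum (I : Type) (r : seq I) (P : pred I) U (F : I -> 'rV[R]_n -> R) :
  open U -> (forall i, P i -> Cinf U (F i)) ->
  Cinf U (fun x => \sum_(i <- r | P i) F i x).
Proof.
move=> oU HF; elim: r => [|i r IH].
  apply: (Cinf_ext oU _ (Cinf_cst U 0)) => x _; by rewrite big_nil.
have Hi : Cinf U (fun x => if P i then F i x else 0).
  by case Pi: (P i); [exact: HF | exact: Cinf_cst].
apply: (Cinf_ext oU _ (Cinf_D oU Hi IH)) => x _.
by rewrite big_cons; case: ifP; rewrite ?add0r.
Qed.

Lemma Cinf_prod (I : Type) (r : seq I) (P : pred I) U (F : I -> 'rV[R]_n -> R) :
  open U -> (forall i, P i -> Cinf U (F i)) ->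
  Cinf U (fun x => \prod_(i <- r | P i) F i x).
Proof.
move=> oU HF; elim: r => [|i r IH].
  apply: (Cinf_ext oU _ (Cinf_cst U 1)) => x _; by rewrite big_nil.
have Hi : Cinf U (fun x => if P i then F i x else 1).
  by case Pi: (P i); [exact: HF | exact: Cinf_cst].
apply: (Cinf_ext oU _ (Cinf_M oU Hi IH)) => x _.
by rewrite big_cons; case: ifP; rewrite ?mul1r.
Qed.

End Calculus.

(** * Flat functions of one variable *)

Lemma derive_line {R : realType} {n} (f : 'rV[R]_n -> R) (x v : 'rV[R]_n) :
  'D_1 (fun h : R => f (h *: v + x)) (0 : R) = 'D_v f x.
Proof.
rewrite /derive; set g1 := fun h => h^-1 *: _; set g2 := fun h => h^-1 *: _.
suff -> : g1 = g2 by [].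
by apply/funext => h; rewrite /g1 /g2 /= addr0 scale0r add0r [_%:A]mulr1.
Qed.

Lemma is_derive_line {R : realType} {n} (f : 'rV[R]_n -> R) (x v : 'rV[R]_n) (d : R) :
  is_derive x v f d <-> is_derive (0 : R) (1 : R) (fun h : R => f (h *: v + x)) d.
Proof.
split=> -[H <-].
  by apply: DeriveDef; [exact: (derivable1P f x v).1 H | exact: derive_line].
apply: DeriveDef; first exact: (derivable1P f x v).2 H.
by rewrite derive_line.
Qed.

Section Theta.
Context {R : realType}.

(** The usual flat function exp (-1/t) together with its multiples by t^-m:
    this family spans a space closed under differentiation, which makes
    smoothness an induction on the order of differentiation. *)
Definition theta (m : nat) (t : R) : R :=
  if 0 < t then t ^- m * expR (- t^-1) else 0.

Lemma theta_gt0 m t : 0 < t -> 0 < theta m t.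
Proof. by move=> t0; rewrite /theta t0 mulr_gt0 ?expR_gt0 // invr_gt0 exprn_gt0. Qed.

Lemma theta_le0 m t : t <= 0 -> theta m t = 0.
Proof. by move=> t0; rewrite /theta ltNge t0. Qed.

(** Quadratic decay at 0, where the exponential series beats every power of
    1/t. It gives the derivative 0 at the origin for all m at once. *)
Lemma theta_sq m t : `|theta m t| <= (m.+2)`!%:R * t ^+ 2.
Proof.
have [t0|t0] := ltP 0 t; last by rewrite theta_le0 // normr0 mulr_ge0 ?sqr_ge0.
rewrite gtr0_norm ?theta_gt0 // /theta t0 expRN.
have e0 := expR_gt0 t^-1; rewrite ler_pdivrMr //.
have := @expR_ge1Dxn R t^-1 m.+1 (ltW _); rewrite invr_gt0 => /(_ t0) H.
have {H} : t^-1 ^+ m.+2 / (m.+2)`!%:R <= expR t^-1 by lra.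
have f0 : 0 < (m.+2)`!%:R :> R by rewrite ltr0n fact_gt0.
rewrite ler_pdivrMr // => H.
have t2 : 0 < t ^+ 2 by rewrite exprn_gt0.
have -> : t ^- m = t^-1 ^+ m.+2 * t ^+ 2.
  by rewrite -addn2 exprD exprVn -mulrA -exprMn mulVf ?gt_eqF // expr1n mulr1.
by nra.
Qed.

Lemma is_derive_theta m (t : R) :
  is_derive t (1 : R) (theta m) (- m%:R * theta m.+1 t + theta m.+2 t).
Proof.
have [t0|] := ltP 0 t.
  have nt : t != 0 by rewrite gt_eqF.
  have E : \forall y \near t,
      (((fun y : R => y^-1) ^+ m) * (expR \o (- (fun y : R => y^-1)))) y = theta m y.
    near=> y; rewrite /theta ifT; last by near: y; exact: lt_nbhsr.
    by rewrite !fctE /= exprVn.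
  apply: (near_eq_is_derive E).
  (* found by instance resolution in the product rule below *)
  have dV : is_derive t 1 (fun y : R => y^-1) (- t ^- 2).
    apply: is_derive_eq; first exact: is_deriveV.
    by rewrite /GRing.scale /= mulr1.
  apply: is_derive_eq.
  rewrite /theta t0 !fctE /GRing.scale /=.
  case: m {E} => [|m] /=; rewrite -!exprVn !exprS; ring.
rewrite le_eqVlt => /predU1P[->|t0].
  rewrite !theta_le0 // mulr0 add0r.
  suff H : (fun h : R => h^-1 *: ((theta m \o shift 0) (h *: 1) - theta m 0))
      @ 0^' --> (0 : R).
    by apply: DeriveDef; [apply/cvg_ex; exists 0 | exact: cvg_lim].
  apply/cvgrPdist_le => e e0; have f0 : 0 < (m.+2)`!%:R :> R.
    by rewrite ltr0n fact_gt0.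
  near=> h; rewrite sub0r normrN /= [h *: 1]mulr1 addr0 (@theta_le0 m 0) // subr0.
  have h0 : h != 0 by near: h; exact: nbhs_dnbhs_neq.
  rewrite normrM normfV ler_pdivrMl ?normr_gt0 //.
  apply: le_trans (theta_sq m h) _.
  rewrite -real_normK ?num_real // expr2 mulrCA ler_wpM2l // mulrC.
  rewrite -ler_pdivlMr //; near: h; apply: dnbhs0_le.
  by rewrite divr_gt0.
rewrite !(theta_le0 _ (ltW t0)) mulr0 add0r.
have D0 : is_derive t 1 (cst 0 : R -> R) 0 by exact: is_derive_cst.
apply: near_eq_is_derive D0.
near=> y; rewrite theta_le0 //; near: y; exact: lt_le_nbhsl.
Unshelve. all: by end_near. Qed.

(** Composition with an affine map l of linear part d: its partial derivatives
    are linear combinations of the same kind of functions. *)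
Lemma Ck_theta_comp n m k (l d : 'rV[R]_n -> R) :
  continuous l -> (forall h (v x : 'rV[R]_n), l (h *: v + x) = h * d v + l x) ->
  Ck k setT (fun x => theta m (l x)).
Proof.
move=> cl hl.
have D p (x v : 'rV[R]_n) : is_derive x v (fun x => theta p (l x))
    ((- p%:R * theta p.+1 (l x) + theta p.+2 (l x)) * d v).
  apply/is_derive_line.
  rewrite (_ : (fun h => _) = theta p \o (fun h : R => h * d v + l x)); last first.
    by apply/funext => h /=; rewrite hl.
  apply: is_derive1_comp; first by rewrite mul0r add0r; exact: is_derive_theta.
  have H : is_derive (0 : R) 1 (d v \*: (id : R -> R) + cst (l x)) (d v *: 1 + 0).
    exact: is_deriveD.
  rewrite (_ : (fun h => _) = d v \*: (id : R -> R) + cst (l x)); last first.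
    by apply/funext => h; rewrite mulrC.
  by apply: (is_derive_eq H); rewrite addr0 [_ *: _]mulr1.
elim: k m => [|k IH] m; (split=> //; first move=> x _).
- apply: (continuous_comp (cl x)); apply/differentiable_continuous.
  by apply/derivable1_diffP; case: (is_derive_theta m (l x)).
- apply: (continuous_comp (cl x)); apply/differentiable_continuous.
  by apply/derivable1_diffP; case: (is_derive_theta m (l x)).
move=> i; split; first by move=> x _; case: (D m x (delta_mx 0 i)).
have oT := @openT 'rV[R]_n.
have C c := @Ck_cst R n k setT c.
have := CkM oT (CkD oT (CkM oT (C (- m%:R)) (IH m.+1)) (IH m.+2)) (C (d (delta_mx 0 i))).
by apply: Ck_ext => // x _; have [_ ->] := D m x (delta_mx 0 i).
Qed.

Lemma Cinf_theta_comp n m (l d : 'rV[R]_n -> R) :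
  continuous l -> (forall h (v x : 'rV[R]_n), l (h *: v + x) = h * d v + l x) ->
  Cinf setT (fun x => theta m (l x)).
Proof. by move=> cl hl k; exact: Ck_theta_comp hl. Qed.

End Theta.

(** * Euclidean space as a manifold *)

Section Euclid.
Context {R : realType} {n : nat}.

Lemma rV_second_countable : @second_countable 'rV[R]_n.
Proof.
pose b (p : 'rV[rat]_n * nat) : set 'rV[R]_n :=
  ball (map_mx ratr p.1 : 'rV[R]_n) (p.2.+1%:R^-1).
exists (b @` setT).
  exact/(card_le_trans (card_image_le _ _))/countableP.
split=> [_ [p _ <-]|x V /nbhs_ballP[e /= e0 xV]].
  by apply: ball_open; rewrite invr_gt0.
have [k] := @ltr_add_invr R 0 (e / 2) (divr_gt0 e0 (ltr0n _ 2)); rewrite add0r => ke.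
have k0 : 0 < k.+1%:R^-1 :> R by rewrite invr_gt0.
(* balls with rational centres and radii 1 / (k + 1) *)
have q_ i : exists q : rat, `|ratr q - x 0 i| < k.+1%:R^-1.
  have [|q] := @rat_in_itvoo R (x 0 i - k.+1%:R^-1) (x 0 i + k.+1%:R^-1).
    by rewrite ltrBlDr -addrA ltrDl addr_gt0.
  by rewrite in_itv /= -ltr_distl => qx; exists q.
have [q qx] := choice q_.
have bx : b (\row_i q i, k) x.
  by split=> //= i j; rewrite !mxE /ball /= ord1; exact: qx.
exists (b (\row_i q i, k)); first by split=> //; exists (\row_i q i, k).
apply: subset_trans xV => y by_; rewrite [e]splitr.
apply: (ball_triangle (y := (map_mx ratr (\row_i q i) : 'rV[R]_n))).
- by apply: le_ball (ltW ke) _ _; exact: ball_sym.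
- exact: le_ball (ltW ke) _ by_.
Qed.

Definition euclid_chart : chart R 'rV[R]_n n.
refine (@Chart R 'rV[R]_n n setT id id openT _ (fun _ _ => erefl) _ _).
- by rewrite image_id; exact: openT.
- by move=> x _; exact: cvg_id.
- by move=> x _; exact: cvg_id.
Defined.

Lemma Cinf_coord (U : set 'rV[R]_n) (l : 'I_n) : Cinf U (fun x => x 0 l).
Proof.
have Did (x v : 'rV[R]_n) : is_derive x v (fun y => y 0 l) (v 0 l).
  have [/derivable_mxP D _] := is_derive_id x v.
  apply: DeriveDef; first exact: D.
  have := @derive_id R 'rV[R]_n x v; rewrite derive_mx; last exact: derivable_id.
  by move=> /(congr1 (fun w : 'rV[R]_n => w 0 l)); rewrite mxE.
have cl : continuous (fun x : 'rV[R]_n => x 0 l) by exact: coord_continuous.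
case=> [|k]; (split; first by move=> x _; exact: cl) => // i.
split=> [x _|]; first by have [] := Did x (delta_mx 0 i).
rewrite (_ : (fun x => _) = fun=> (delta_mx 0 i : 'rV[R]_n) 0 l); first exact: Ck_cst.
by apply/funext => x; rewrite derive_val.
Qed.

Definition euclid : manifold R.
refine (@Manifold R 'rV[R]_n n (@norm_hausdorff _ _) rV_second_countable unit
  (fun=> euclid_chart) (fun=> tt) (fun _ => I) _).
by move=> _ _ l; exact: Cinf_coord.
Defined.
End Euclid.

(** * Smooth and compactly supported objects on Euclidean space *)

Section SmoothObjects.
Context {R : realType} {n : nat}.
Local Notation E := (@euclid R n).
Implicit Types (U : set 'rV[R]_n) (f h : 'rV[R]_n -> R).

Lemma smooth_onE U f : smooth_on (M := E) U f <-> Cinf U f.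
Proof.
rewrite /smooth_on /= image_id setIT.
by split=> [/(_ tt)|H []].
Qed.

Lemma local_repE (i : cidx E) (X : vfield E) : local_rep i X = X.
Proof. by apply/funext => y; rewrite /local_rep /tcoord /=; exact: derive_id. Qed.

Lemma smooth_vf_onE U (X : vfield E) :
  smooth_vf_on (M := E) U X <-> forall l, Cinf U (fun y => (X y : 'rV[R]_n) 0 l).
Proof.
rewrite /smooth_vf_on /= image_id setIT.
split=> [H l|H i l]; first by have := H tt l; rewrite local_repE.
by rewrite local_repE; exact: H.
Qed.

(** The values may lie in varying fibres, so that the lemma covers functions,
    vector fields and sections of bundles alike. *)
Lemma closure_sub_compact (T : 'rV[R]_n -> zmodType) (f : forall x, T x) (K : set 'rV[R]_n) :
  compact K -> (forall x, ~ K x -> f x = 0) ->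
  compact (closure [set x | f x != 0]) /\ closure [set x | f x != 0] `<=` K.
Proof.
move=> cK fK.
have cK' : closed K by apply: compact_closed => //; exact: norm_hausdorff.
have sub : closure [set x | f x != 0] `<=` K.
  rewrite [X in _ `<=` X](closure_id K).1 //; apply: closureS => x /= /eqP fx.
  by apply: contrapT => /fK.
by split=> //; apply: subclosed_compact cK sub; exact: closed_closure.
Qed.

Lemma CcP U f : Cc (M := E) U f <-> Cinf setT f /\ exists K : set 'rV[R]_n,
  [/\ compact K, K `<=` U & forall x, ~ K x -> f x = 0].
Proof.
split=> [[/smooth_onE sf cf fU]|[sf [K [cK KU fK]]]].
  split=> //; exists (closure [set x | f x != 0]); split=> // x.
  by move=> nx; apply/eqP; apply: contrapT => /negP fx; apply: nx; exact: subset_closure.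
have [c1 c2] := closure_sub_compact cK fK.
by split=> //; [exact/smooth_onE | exact: subset_trans KU].
Qed.

Lemma Cc_Cinf U f : Cc (M := E) U f -> Cinf setT f.
Proof. by move=> /CcP[]. Qed.

Lemma Cc_sub U V f : U `<=` V -> Cc (M := E) U f -> Cc (M := E) V f.
Proof. by move=> UV [? ? ?]; split=> //; exact: subset_trans UV. Qed.

Lemma Cc0 U : Cc (M := E) U (fun=> 0).
Proof.
apply/CcP; split; first exact: Cinf_cst.
by exists set0; split=> //; exact: compact0.
Qed.

Lemma CcD U f h : Cc (M := E) U f -> Cc (M := E) U h ->
  Cc (M := E) U (fun x => f x + h x).
Proof.
move=> /CcP[sf [K [cK KU fK]]] /CcP[sh [L [cL LU hL]]]; apply/CcP; split.
  by apply: Cinf_D => //; exact: openT.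
exists (K `|` L); split; first exact: compactU.
- by move=> x [/KU|/LU].
- by move=> x /not_orP[/fK -> /hL ->]; rewrite addr0.
Qed.

(** The product extends smoothly by zero since the open sets U and the
    complement of the support of f cover the space. *)
Lemma CcM U f h : open U -> Cinf U h -> Cc (M := E) U f ->
  Cc (M := E) U (fun x => h x * f x).
Proof.
move=> oU sh /CcP[sf [K [cK KU fK]]]; apply/CcP; split; last first.
  by exists K; split=> // x /fK ->; rewrite mulr0.
have oK : open (~` K).
  by apply: closed_openC; apply: compact_closed => //; exact: norm_hausdorff.
rewrite (_ : setT = U `|` ~` K); last first.
  by apply/esym/seteqP; split=> // x _; have [/KU|] := pselect (K x); [left|right].
apply: Cinf_union.
  by apply: Cinf_M => //; exact: Cinf_sub sf.
by apply: (Cinf_ext oK _ (Cinf_cst _ 0)) => x /fK ->; rewrite mulr0.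
Qed.

Lemma Cc_sum (I : Type) (r : seq I) (P : pred I) U (F : I -> 'rV[R]_n -> R) :
  (forall i, P i -> Cc (M := E) U (F i)) ->
  Cc (M := E) U (fun x => \sum_(i <- r | P i) F i x).
Proof.
move=> HF; elim: r => [|i r IH].
  rewrite (_ : (fun x => \sum_(_ <- _ | _) _) = fun=> 0); first exact: Cc0.
  by apply/funext => x; rewrite big_nil.
case Pi: (P i).
  rewrite (_ : (fun x => \sum_(_ <- _ | _) _) = fun x => F i x + \sum_(j <- r | P j) F j x).
    by apply: CcD => //; exact: HF.
  by apply/funext => x; rewrite big_cons Pi.
rewrite (_ : (fun x => \sum_(_ <- _ | _) _) = fun x => \sum_(j <- r | P j) F j x) //.
by apply/funext => x; rewrite big_cons Pi.
Qed.

Lemma Cinf_theta_affine (i j : 'I_n) (a b c : R) :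
  Cinf setT (fun x : 'rV[R]_n => theta 0 (a * x 0 i + b * x 0 j + c)).
Proof.
apply: (@Cinf_theta_comp _ _ _ _ (fun v => a * v 0 i + b * v 0 j)); last first.
  by move=> h v x; rewrite !mxE; ring.
have cM d l : continuous (fun x : 'rV[R]_n => d * x 0 l).
  move=> x; apply: (@continuousM _ _ (cst d) (fun x : 'rV[R]_n => x 0 l)).
    exact: cst_continuous.
  exact: coord_continuous.
move=> x; apply: (@continuousD _ _ _ (fun x : 'rV[R]_n => a * x 0 i + b * x 0 j) (cst c)).
  by apply: (@continuousD _ _ _ (fun x : 'rV[R]_n => a * x 0 i)); exact: cM.
exact: cst_continuous.
Qed.

Lemma closed_ball_compact (p : 'rV[R]_n) (r : R) : 0 < r -> compact (closed_ball p r).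
Proof.
move=> r0; apply: bounded_closed_compact; last exact: closed_ball_closed.
rewrite closed_ballE //; exists (`|p| + r); split; first exact: num_real.
move=> M HM x /= px; apply: le_trans (ltW HM).
rewrite -[x](subKr p); apply: le_trans (ler_normB _ _) _.
by rewrite lerD2l.
Qed.

(** Balls for the sup norm are cubes, so a product of flat functions of the
    coordinates does the job. *)
Lemma ball_bump (p : 'rV[R]_n) (r : R) : 0 < r -> exists chi : 'rV[R]_n -> R,
  [/\ Cinf setT chi, forall x, ball p r x -> chi x != 0
    & forall x, ~ ball p r x -> chi x = 0].
Proof.
move=> r0; pose b l (x : 'rV[R]_n) :=
  theta 0 (1 * x 0 l + 0 * x 0 l + (r - p 0 l))
  * theta 0 (-1 * x 0 l + 0 * x 0 l + (r + p 0 l)).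
have bP l (x : 'rV[R]_n) : `|p 0 l - x 0 l| < r -> b l x != 0.
  by rewrite ltr_norml => /andP[h1 h2]; rewrite mulf_neq0 // gt_eqF // theta_gt0 //; lra.
have bN l (x : 'rV[R]_n) : r <= `|p 0 l - x 0 l| -> b l x = 0.
  move=> h; apply/eqP; rewrite mulf_eq0; move: h; rewrite ler_normr => /orP[] h; apply/orP.
    by left; rewrite theta_le0 //; lra.
  by right; rewrite theta_le0 //; lra.
exists (fun x => \prod_l b l x); split.
- apply: Cinf_prod => [|l _]; first exact: openT.
  by apply: Cinf_M; [exact: openT|exact: Cinf_theta_affine|exact: Cinf_theta_affine].
- move=> x [_ px]; apply/prodf_neq0 => l _; apply: bP; exact: px.
- move=> x npx; apply/eqP/prodf_eq0; apply: contrapT => H; apply: npx.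
  split=> // i l; rewrite ord1; apply: contrapT => /negP; rewrite -leNgt => /bN h.
  by apply: H; exists l; rewrite ?h.
Qed.

Lemma Cc_bump (p : 'rV[R]_n) U : open U -> U p ->
  exists chi, Cc (M := E) U chi /\ chi p != 0.
Proof.
move=> oU Up; have /nbhs_ballP[e /= e0 eU] : nbhs p U by exact: open_nbhs_nbhs.
have e20 : 0 < e / 2 by rewrite divr_gt0.
have [chi [schi chi1 chi0]] := ball_bump p e20.
exists chi; split; last by apply: chi1; exact: ballxx.
apply/CcP; split=> //; exists (closed_ball p (e / 2)); split.
- exact: closed_ball_compact.
- by apply: subset_trans eU; exact: subset_closure_half.
- by move=> x nx; apply: chi0 => /subset_closed_ball.
Qed.

End SmoothObjects.

(** * Foliations generated by disjointly supported multiples of a coordinate field *)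

Section DirDeriv.
Context {R : realType} {n : nat}.

(** Scaling the direction only reparametrizes the line through x along v, so
    the one-variable chain rule applies. *)
Lemma is_derive_dirZ (f : 'rV[R]_n -> R) (x v : 'rV[R]_n) (c : R) :
  derivable f x v -> is_derive x (c *: v) f (c * 'D_v f x).
Proof.
move=> /derivableP/is_derive_line Hf; apply/is_derive_line.
rewrite (_ : (fun h => _) = (fun h : R => f (h *: v + x)) \o (c \*: (id : R -> R))); last first.
  by apply/funext => h /=; rewrite scalerA mulrC.
have H : is_derive (0 : R) (1 : R) (c \*: (id : R -> R)) (c *: 1) by exact: is_deriveZ.
have c0 : (c \*: (id : R -> R)) 0 = 0 by exact: mulr0.
rewrite -c0 in Hf; apply: is_derive_eq.
by rewrite [c *: 1]mulr1 mulrC.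
Qed.

Lemma derive_mulvec (f : 'rV[R]_n -> R) (w x v : 'rV[R]_n) :
  derivable f x v -> 'D_v (fun y => f y *: w) x = 'D_v f x *: w.
Proof.
move=> df.
have H i j : is_derive x v (fun y => (f y *: w) i j) ('D_v f x * w i j).
  rewrite (_ : (fun y => _) = w i j \*: f); last first.
    by apply/funext => y /=; rewrite mxE mulrC.
  rewrite mulrC; apply: is_deriveZ; exact: derivableP.
rewrite derive_mx; last by apply/derivable_mxP => i j; case: (H i j).
by apply/matrixP => i j; rewrite !mxE; case: (H i j).
Qed.

End DirDeriv.

Section LineFoliation.
Context {R : realType} {n : nat} (i0 : 'I_n).
Variable g : nat -> 'rV[R]_n -> R.
Local Notation E := (@euclid R n).
Local Notation D f := ('D_(delta_mx 0 i0 : 'rV[R]_n) f).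

Definition linefield (f : 'rV[R]_n -> R) : vfield E :=
  fun x => f x *: (delta_mx 0 i0 : 'rV[R]_n).

Definition lincomb N (h : nat -> 'rV[R]_n -> R) x := \sum_(m < N) h m x * g m x.

Definition linefol : set (vfield E) :=
  [set X | exists N h, (forall m, Cc (M := E) setT (h m)) /\ X = linefield (lincomb N h)].

Hypothesis g_smooth : forall m, Cinf setT (g m).
Hypothesis g_disj : forall (m k : nat) x, m != k -> g m x * g k x = 0.
Hypothesis g_fin : forall K : R, exists N : nat, forall m (x : 'rV[R]_n),
  (N <= m)%N -> `|x| < K -> g m x = 0.

Lemma lie_bracket_line f h x :
  derivable f x (delta_mx 0 i0) -> derivable h x (delta_mx 0 i0) ->
  lie_bracket (linefield f) (linefield h) x
    = (f x * D h x - h x * D f x) *: (delta_mx 0 i0 : 'rV[R]_n).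
Proof.
move=> df dh; rewrite /lie_bracket !local_repE /linefield /=.
have [df1 df2] := is_derive_dirZ (h x) df; have [dh1 dh2] := is_derive_dirZ (f x) dh.
by rewrite !derive_mulvec // df2 dh2 -scalerBl.
Qed.

Lemma linefield_Xc U f : Cc (M := E) U f -> Xc U (linefield f).
Proof.
move=> /CcP[sf [K [cK KU fK]]].
have [|c1 c2] := @closure_sub_compact R n (fun=> 'rV[R]_n) (linefield f) K cK _.
  by move=> x /fK fx; rewrite /linefield fx scale0r.
split=> //; last exact: subset_trans KU.
apply/smooth_vf_onE => l.
apply: (Cinf_ext openT _ (Cinf_M openT sf (Cinf_cst _ ((delta_mx 0 i0 : 'rV[R]_n) 0 l)))).
by move=> x _; rewrite /linefield [RHS]mxE.
Qed.

Lemma lincomb_Cc U N h : (forall m, Cc (M := E) U (h m)) -> open U ->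
  Cc (M := E) U (lincomb N h).
Proof.
move=> Hh oU; apply: Cc_sum => m _.
rewrite (_ : (fun x => _) = fun x => g m x * h m x); last first.
  by apply/funext => x; rewrite mulrC.
apply: CcM (Hh m) => //; exact: Cinf_sub (g_smooth m).
Qed.

(** Padding with zero coefficients puts two elements of the foliation over the
    same finite set of generators. *)
Lemma lincomb_extend N N' h : (N <= N')%N -> (forall m, Cc (M := E) setT (h m)) ->
  exists h', (forall m, Cc (M := E) setT (h' m)) /\ lincomb N h = lincomb N' h'.
Proof.
move=> NN' Hh; exists (fun m => if (m < N)%N then h m else fun=> 0); split.
  by move=> m; case: ifP => // _; exact: Cc0.
apply/funext => x; rewrite /lincomb (big_ord_widen _ (fun m => h m x * g m x) NN').
by rewrite big_mkcond; apply: eq_bigr => m _; case: ifP; rewrite ?mul0r.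
Qed.

Lemma linefol_pair X Y : linefol X -> linefol Y -> exists N a b,
  [/\ forall m, Cc (M := E) setT (a m), forall m, Cc (M := E) setT (b m),
    X = linefield (lincomb N a) & Y = linefield (lincomb N b)].
Proof.
move=> [N [a [Ha ->]]] [N' [b [Hb ->]]].
have [a' [Ha' ->]] := lincomb_extend (leq_maxl N N') Ha.
have [b' [Hb' ->]] := lincomb_extend (leq_maxr N N') Hb.
by exists (maxn N N'), a', b'.
Qed.

Lemma linefol_submodule : submodule setT linefol.
Proof.
split.
- by move=> X [N [h [Hh ->]]]; apply/linefield_Xc/lincomb_Cc => //; exact: openT.
- exists 0, (fun _ _ => 0); split; first by move=> _; exact: Cc0.
  by apply/funext => x; rewrite /linefield /lincomb big_ord0 scale0r.
- move=> X Y /linefol_pair H /H [N [a [b [Ha Hb -> ->]]]].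
  exists N, (fun m x => a m x + b m x); split; first by move=> m; exact: CcD.
  apply/funext => x; rewrite /linefield /lincomb -scalerDl -big_split /=.
  by congr (_ *: _); apply: eq_bigr => m _; rewrite mulrDl.
- move=> h X /smooth_onE sh [N [a [Ha ->]]].
  exists N, (fun m x => h x * a m x); split; first by move=> m; exact: CcM openT _ _.
  apply/funext => x; rewrite /linefield /lincomb scalerA mulr_sumr.
  by congr (_ *: _); apply: eq_bigr => m _; rewrite mulrA.
Qed.

(** Where g_m does not vanish, g_k vanishes on a whole neighbourhood. *)
Lemma g_disj_derive (m k : nat) x i : m != k -> g m x * 'D_(delta_mx 0 i) (g k) x = 0.
Proof.
move=> mk; have [->|gm] := eqVneq (g m x) 0; first by rewrite mul0r.
rewrite (@near_eq_derive _ _ _ (g k) (cst 0)) ?derive_cst ?mulr0 //.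
have cg : {for x, continuous (g m)} by exact: (Cinf_continuous (g_smooth m)).
have gmN : \forall y \near x, g m y != 0 by exact: (cvgr_neq0 _ cg gm).
apply: filterS gmN => y /= gy; have /eqP := g_disj y mk.
by rewrite mulf_eq0 (negbTE gy) => /eqP.
Qed.

(** Since the mixed terms vanish, the coefficient of the bracket at the m-th
    generator is g_m (a_m b_m' - b_m a_m'), again compactly supported. *)
Lemma linefol_bracket X Y : linefol X -> linefol Y -> linefol (lie_bracket X Y).
Proof.
move=> /linefol_pair H /H [N [a [b [Ha Hb -> ->]]]].
exists N, (fun m x => g m x * (D (b m) x) * a m x + (- (g m x) * D (a m) x) * b m x).
have oT := @openT 'rV[R]_n.
have sD f : Cc (M := E) setT f -> Cinf setT (D f).
  by move=> /Cc_Cinf /Cinf_derive.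
split.
  move=> m; apply: CcD; apply: CcM => //.
    exact: Cinf_M (sD _ (Hb m)).
  apply: Cinf_M (sD _ (Ha m)) => //.
  apply: (Cinf_ext oT _ (Cinf_M oT (Cinf_cst _ (-1)) (g_smooth m))) => x _.
  by rewrite mulN1r.
have dd f x : Cinf setT f -> derivable f x (delta_mx 0 i0).
  by move=> /Cinf_derivable; apply.
have dlincomb h x : (forall m, Cc (M := E) setT (h m)) ->
    D (lincomb N h) x = \sum_(m < N) (h m x * D (g m) x + g m x * D (h m) x).
  move=> Hh; rewrite (_ : lincomb N h = \sum_(m < N) (h m * g m)); last first.
    by apply/funext => y; rewrite fct_sumE.
  rewrite derive_sum => [|m]; last by apply: derivableM; apply: dd => //; exact: Cc_Cinf (Hh m).
  apply: eq_bigr => m _; rewrite deriveM //; apply: dd => //; exact: Cc_Cinf (Hh m).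
apply/funext => x; rewrite lie_bracket_line; last 2 first.
- by apply: dd; exact: Cc_Cinf (lincomb_Cc N Ha oT).
- by apply: dd; exact: Cc_Cinf (lincomb_Cc N Hb oT).
rewrite /linefield; congr (_ *: _).
have pick (h : nat -> 'rV[R]_n -> R) (m : 'I_N) :
    g m x * (\sum_(k < N) (h k x * D (g k) x + g k x * D (h k) x))
    = g m x * (h m x * D (g m) x + g m x * D (h m) x).
  rewrite mulr_sumr (bigD1 m) //= big1 ?addr0 // => k km.
  have mk : (m : nat) != k by rewrite eq_sym.
  by rewrite mulrDr mulrCA g_disj_derive // mulr0 add0r mulrA g_disj // mul0r.
rewrite !dlincomb // /lincomb !mulr_suml -sumrB; apply: eq_bigr => m _.
by rewrite -!mulrA !pick; ring.
Qed.

Lemma submodule_sum U G (I : Type) (r : seq I) (Y : I -> vfield E) :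
  submodule (M := E) U G -> (forall i, G (Y i)) ->
  G (fun x => \sum_(i <- r) Y i x : 'rV[R]_n).
Proof.
move=> [_ G0 GD _] GY; elim: r => [|i r IH].
  rewrite (_ : (fun x => _) = fun x => 0) //.
  by apply/funext => x; rewrite big_nil.
rewrite (_ : (fun x => _) = fun x => Y i x + \sum_(j <- r) Y j x); first exact: GD.
by apply/funext => x; rewrite big_cons.
Qed.

Lemma linefol_gen m f : Cc (M := E) setT f -> linefol (linefield (fun y => f y * g m y)).
Proof.
move=> cf; exists m.+1, (fun k => if k == m then f else fun=> 0); split.
  by move=> k; case: eqP => // _; exact: Cc0.
congr linefield; apply/funext => x; rewrite /lincomb big_ord_recr /= eqxx.
rewrite big1 ?add0r // => k _; rewrite ifF ?mul0r //.
by apply/eqP => ki; have := ltn_ord k; rewrite ki ltnn.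
Qed.

(** On a ball U, all but finitely many g_m vanish identically, and the others
    generate. For the inclusion of their span in F_U, let chi be a compactly
    supported function that is nonzero exactly on U. Then chi g_i e0 is in F,
    so f_i chi g_i e0 is in F_U, and F_U is stable under multiplication by
    1 / chi, which is smooth on U. *)
Lemma linefol_fg : locally_fg linefol.
Proof.
move=> p; pose r := `|p : 'rV[R]_n| + 1.
have r0 : 0 < r by rewrite ltr_wpDl.
pose U : set 'rV[R]_n := ball (0 : 'rV[R]_n) r.
have UP x : U x -> `|x| < r by rewrite /U mx_norm_ball /ball_ /= sub0r normrN.
have oU : open U by exact: ball_open.
exists U; split=> //; first by rewrite /U mx_norm_ball /ball_ /= sub0r normrN ltrDl.
have [N HN] := g_fin r.
exists N, (fun m => linefield (g m)); split.
  move=> m; apply/smooth_vf_onE => l.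
  have sc := @Cinf_cst R n setT ((delta_mx 0 i0 : 'rV[R]_n) 0 l).
  apply: (Cinf_ext openT _ (Cinf_M openT (g_smooth m) sc)).
  by move=> x _; rewrite /linefield [RHS]mxE.
have lf_sum (f : 'I_N -> E -> R) : (fun y => \sum_i f i y *: linefield (g i) y)
    = linefield (fun x => \sum_i f i x * g i x).
  apply/funext => y; rewrite /linefield scaler_suml.
  by apply: eq_bigr => i _; rewrite scalerA.
apply/seteqP; split.
- apply: smallest_sub; first split.
  + move=> _ [f Hf ->]; rewrite lf_sum; apply: linefield_Xc; apply: Cc_sum => i _.
    rewrite (_ : (fun x => _) = fun x => g i x * f i x); last first.
      by apply/funext => x; rewrite mulrC.
    by apply: CcM (Hf i) => //; exact: Cinf_sub (g_smooth i).
  + exists (fun _ _ => 0); first by move=> i; exact: Cc0.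
    by apply/funext => y; rewrite big1 // => i _; rewrite scale0r.
  + move=> _ _ [f Hf ->] [f' Hf' ->]; exists (fun i x => f i x + f' i x).
      by move=> i; exact: CcD.
    apply/funext => y; rewrite -big_split /=.
    by apply: eq_bigr => i _; rewrite scalerDl.
  + move=> h _ /smooth_onE sh [f Hf ->]; exists (fun i x => h x * f i x).
      by move=> i; exact: CcM.
    apply/funext => y; rewrite scaler_sumr.
    by apply: eq_bigr => i _; rewrite scalerA.
  move=> _ [f [_ [Hf [N' [h [Hh ->]]] ->]]].
  exists (fun i x => if (i < N')%N then h i x * f x else 0).
    move=> i; case iN: (i < N')%N; last exact: Cc0.
    by apply: CcM => //; exact: Cinf_sub (Cc_Cinf (Hh i)).
  rewrite lf_sum; apply/funext => x; rewrite /linefield scalerA; congr (_ *: _).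
  have [fx|fx] := eqVneq (f x) 0.
    by rewrite fx mul0r big1 // => i _; case: ifP; rewrite ?mulr0 ?mul0r.
  have Ux : U x.
    by have [_ _] := Hf; apply; apply: subset_closure.
  have N1 : (N' <= maxn N' N)%N by exact: leq_maxl.
  have N2 : (N <= maxn N' N)%N by exact: leq_maxr.
  rewrite /lincomb mulr_sumr (big_ord_widen _ (fun m => f x * (h m x * g m x)) N1).
  rewrite (big_ord_widen _ (fun m => (if (m < N')%N then h m x * f x else 0) * g m x) N2).
  rewrite [LHS]big_mkcond [RHS]big_mkcond; apply: eq_bigr => m _.
  have [mN|mN] := ltnP m N; first by case: ifP; rewrite ?mul0r // mulrCA mulrA.
  by rewrite (HN m x mN (UP _ Ux)) !mulr0; case: ifP.
- move=> _ [f Hf ->] G [sG GG].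
  apply: (@submodule_sum U) => // i.
  have [chi [schi chi1 chi0]] := @ball_bump R n 0 r r0.
  have cchi : Cc (M := E) setT chi.
    apply/CcP; split=> //; exists (closed_ball 0 r); split=> //.
      exact: closed_ball_compact.
    by move=> x nx; apply: chi0 => /subset_closed_ball.
  have [_ _ _ GM] := sG.
  pose X x := f i x *: linefield (fun y => chi y * g i y) x.
  rewrite (_ : (fun x => _) = fun x => (chi x)^-1 *: X x); last first.
    apply/funext => x; rewrite /X /linefield !scalerA.
    have [fx|fx] := eqVneq (f i x) 0; first by rewrite fx !(mul0r, mulr0).
    have Ux : U x by have [_ _] := Hf i; apply; apply: subset_closure.
    have cx := chi1 _ Ux; congr (_ *: _); by field.
  apply: (GM (fun x => (chi x)^-1) X).
    apply/smooth_onE; apply: Cinf_V => //; exact: Cinf_sub schi.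
  apply: GG; exists (f i), (linefield (fun y => chi y * g i y)); split=> //.
  exact: linefol_gen.
Qed.

Lemma linefol_singular : singular_foliation linefol.
Proof.
split; [exact: linefol_submodule | exact: linefol_bracket | exact: linefol_fg].
Qed.

End LineFoliation.

(** * The rank of a vector bundle over Euclidean space *)

Section BundleRank.
Context {R : realType}.

Lemma fcoordZ (M : manifold R) (B : vbundle M) (j : tidx B) x (c : R) (v : fiber B x) :
  tdom j x -> fcoord j (c *: v) = c *: fcoord j v.
Proof.
move=> jx; rewrite -{1}(fcoordK jx v) -linearZ; exact: frameK.
Qed.

Lemma frame_sum (M : manifold R) (B : vbundle M) (j : tidx B) x (v : fiber B x) :
  tdom j x -> v = \sum_l fcoord j v 0 l *: frame j x (delta_mx 0 l).
Proof.
move=> jx; rewrite -{1}(fcoordK jx v) {1}(row_sum_delta (fcoord j v)) linear_sum.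
by apply: eq_bigr => l _; rewrite linearZ.
Qed.

(** The matrix P of the change of trivialization is injective. *)
Lemma trank_le (M : manifold R) (B : vbundle M) (i j : tidx B) x :
  tdom i x -> tdom j x -> (trank i <= trank j)%N.
Proof.
move=> ix jx.
pose P : 'M[R]_(trank i, trank j) :=
  \matrix_(k, l) fcoord j (frame i x (delta_mx 0 k)) 0 l.
have rowP k : row k P = fcoord j (frame i x (delta_mx 0 k)).
  by apply/rowP => l; rewrite !mxE.
have framePE w : frame j x (w *m P) = frame i x w.
  rewrite mulmx_sum_row linear_sum {2}(row_sum_delta w) linear_sum.
  by apply: eq_bigr => k _; rewrite !linearZ rowP fcoordK.
suff : row_free P by rewrite /row_free => /eqP <-; exact: rank_leq_col.
rewrite -kermx_eq0; apply/rowV0P => w /sub_kermxP wP.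
have := framePE w; rewrite wP linear0 => fw.
by rewrite -(frameK ix w) -fw -[X in fcoord i X](linear0 (frame i x)) frameK.
Qed.

Lemma trank_eq (M : manifold R) (B : vbundle M) (i j : tidx B) x :
  tdom i x -> tdom j x -> trank i = trank j.
Proof. by move=> ix jx; apply/eqP; rewrite eqn_leq !(@trank_le _ _ _ _ x). Qed.

(** The rank is locally constant, and so constant along the segment from x
    to y. *)
Lemma trank_const n (B : vbundle (@euclid R n)) (i j : tidx B) x y :
  tdom i x -> tdom j y -> trank i = trank j.
Proof.
move=> ix jy.
pose ga (t : R) : 'rV[R]_n := (x : 'rV[R]_n) + t *: ((y : 'rV[R]_n) - x).
have cga : continuous ga.
  move=> t; apply: cvgD; first exact: cvg_cst.
  by apply: cvgZr_tmp; exact: cvg_id.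
(* Q is a property of ranks; taking it to be 'equal to trank i' and its
   negation gives two complementary open sets of parameters *)
pose S (Q : nat -> Prop) : set R := [set t | exists k, tdom (v:=B) k (ga t) /\ Q (trank k)].
have oS Q : open (S Q).
  rewrite (_ : S Q = \bigcup_(k in [set k | Q (trank k)]) (ga @^-1` (tdom (v:=B) k))).
    by apply: bigcup_open => k _; apply: open_comp (tdom_open k) => t _; exact: cga.
  by apply/seteqP; split=> [t [k [kt Qk]]|t [k Qk kt]]; exists k.
have cT : connected [set: R] by apply/connected_intervalP.
have ST : S (fun r => r = trank i) = setT.
  apply: cT.
  - exists 0; exists i; split=> //; by rewrite /ga scale0r addr0.
  - by exists (S (fun r => r = trank i)) => //; rewrite setTI.
  - exists (S (fun r => r = trank i)); last by rewrite setTI.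
    rewrite (_ : S _ = ~` S (fun r => r <> trank i)); first exact: open_closedC.
    apply/seteqP; split=> [t [k [kt kr]] [k' [k't k'r]]|t nt].
      by apply: k'r; rewrite -kr; exact: trank_eq k't kt.
    have [k kt] := tdom_cover B (ga t); exists k; split=> //.
    by apply: contrapT => kr; apply: nt; exists k.
have [k [ky <-]] : S (fun r => r = trank i) 1 by rewrite ST.
by apply: trank_eq jy; rewrite /ga scale1r addrC subrK in ky.
Qed.

End BundleRank.

(** * Lower bound for the rank of an algebroid inducing such a foliation *)

Section RankBound.
Context {R : realType} {n : nat} (i0 : 'I_n).
Variable g : nat -> 'rV[R]_n -> R.
Local Notation E := (@euclid R n).
Hypothesis g_smooth : forall m, Cinf setT (g m).
Hypothesis g_disj : forall (m k : nat) x, m != k -> g m x * g k x = 0.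

(** Where g_m does not vanish, the m-th term is the only one left of a field of
    the foliation. The coefficients b are set to 0 beyond the finitely many
    generators that occur, so that they are indexed by all m. *)
Lemma linefol_at X : linefol i0 g X -> exists b : nat -> 'rV[R]_n -> R,
  (forall m, Cinf setT (b m)) /\
  forall m x, g m x != 0 -> X x = linefield i0 (fun y => b m y * g m y) x.
Proof.
move=> [N [h [Hh ->]]]; exists (fun m => if (m < N)%N then h m else fun=> 0); split.
  by move=> m; case: ifP => _; [exact: Cc_Cinf (Hh m) | exact: Cinf_cst].
move=> m x gm; rewrite /linefield; congr (_ *: _).
have gk (k : nat) : k != m -> h k x * g k x = 0.
  move=> km; have /eqP := g_disj x km.
  by rewrite mulf_eq0 (negbTE gm) orbF => /eqP ->; rewrite mulr0.
rewrite /lincomb; case: ifPn => mN.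
  rewrite (bigD1 (Ordinal mN)) //= big1 ?addr0 // => k km; exact: gk.
rewrite mul0r big1 // => k _; apply: gk; apply/eqP => km; by rewrite -km ltn_ord in mN.
Qed.

(** Frames are only defined over the domain of a trivialization; the cut-off
    turns them into global sections, which the anchor maps into the
    foliation. *)
Lemma frame_bump_sect (A : vbundle E) (j : tidx A) phi l :
  Cc (M := E) (tdom j) phi ->
  Cc_sect (fun x => phi x *: frame j x (delta_mx 0 l) : fiber A x).
Proof.
move=> /CcP[sphi [K [cK KU pK]]].
have oK : open (~` K).
  by apply: closed_openC; apply: compact_closed => //; exact: norm_hausdorff.
split; last first.
  have sK x : ~ K x -> phi x *: frame j x (delta_mx 0 l) = 0.
    by move=> /pK ->; rewrite scale0r.
  exact: (closure_sub_compact (T := fun x => fiber A x) cK sK).1.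
move=> j' l'; apply/smooth_onE.
pose W : set 'rV[R]_n := tdom j'; pose V : set 'rV[R]_n := tdom j.
have oW : open W := tdom_open j'; have oV : open V := tdom_open j.
rewrite (_ : tdom j' = (V `&` W) `|` (W `&` ~` K)); last first.
  apply/seteqP; split=> x; last by move=> [[]|[]].
  by move=> Wx; have [/KU|] := pselect (K x); [left|right].
apply: Cinf_union.
  have oVW : open (V `&` W) by exact: openI.
  have /smooth_onE tc := triv_compat l l'.
  apply: (Cinf_ext oVW _ (Cinf_M oVW (Cinf_sub (@subsetT _ _) sphi) tc)) => x [Vx Wx].
  by rewrite fcoordZ // mxE.
have oWK : open (W `&` ~` K) by exact: openI.
apply: (Cinf_ext oWK _ (Cinf_cst _ 0)) => x [Wx Kx].
by rewrite fcoordZ // pK // scale0r mxE.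
Qed.

Lemma closure_eq0_at (U S : set 'rV[R]_n) (f : 'rV[R]_n -> R) p :
  open U -> U p -> closure S p -> {for p, continuous f} ->
  (forall x, U x -> S x -> f x = 0) -> f p = 0.
Proof.
move=> oU Up Sp cf f0; apply/eqP; apply: contrapT => /negP fp.
have N : \forall y \near p, f y != 0 by exact: (cvgr_neq0 _ cf fp).
have NU : nbhs p U by exact: open_nbhs_nbhs.
have [x [Sx [/= fx Ux]]] := Sp _ (filterI N NU).
by rewrite f0 ?eqxx in fx.
Qed.

(** The m generators with p in the closure of their supports factor through the
    frame fields, which number [trank j]. *)
Lemma rank_bound (A : lie_algebroid E) (j : tidx A) p m (io : 'I_m -> nat) :
  linefol i0 g = induced_foliation A -> tdom j p -> injective io ->
  (forall i, closure [set x | g (io i) x != 0] p) ->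
  (m <= trank j)%N.
Proof.
move=> FA jp io_inj cl.
have oV : open (tdom j : set 'rV[R]_n) := tdom_open j.
have [phi [cphi phip]] := Cc_bump oV jp.
have cphiT : Cc (M := E) setT phi by exact: Cc_sub cphi.
have Xa i : exists a : sect A, Cc_sect a /\
    linefield i0 (fun y => phi y * g (io i) y) = fun x => anchor A x (a x).
  have : linefol i0 g (linefield i0 (fun y => phi y * g (io i) y)) by exact: linefol_gen.
  by rewrite FA => -[a Ha Hx]; exists a.
have [a Ha] := choice Xa.
have Yb l : exists b : nat -> 'rV[R]_n -> R, (forall k, Cinf setT (b k)) /\
    forall k x, g k x != 0 -> anchor A x (phi x *: frame j x (delta_mx 0 l))
      = linefield i0 (fun y => b k y * g k y) x.
  apply: (@linefol_at (fun x => anchor A x (phi x *: frame j x (delta_mx 0 l)))).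
  by rewrite FA; exists (fun x => phi x *: frame j x (delta_mx 0 l)) => //; exact: frame_bump_sect.
have [b Hb] := choice Yb.
pose c i l (x : 'rV[R]_n) := fcoord j (a i x) 0 l.
(* both sides are the coefficient of g_(io k) in phi^2 g_(io i) e0; one factor
   phi makes the left hand field compactly supported, the other one cuts off
   the frame *)
have key i k x : tdom j x -> g (io k) x != 0 ->
    phi x ^+ 2 * (i == k)%:R = \sum_l c i l x * b l (io k) x.
  move=> jx gk.
  have gi : g (io i) x = (i == k)%:R * g (io k) x.
    have [->|ik] := eqVneq i k; first by rewrite mul1r.
    have ne : io i != io k by rewrite (inj_eq io_inj).
    by have /eqP := g_disj x ne; rewrite mulf_eq0 (negbTE gk) orbF mul0r => /eqP.
  have [_ /(congr1 (fun X : vfield E => phi x *: X x))] := Ha i.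
  have T l : phi x *: anchor A x (fcoord j (a i x) 0 l *: frame j x (delta_mx 0 l))
      = c i l x *: linefield i0 (fun y => b l (io k) y * g (io k) y) x.
    by rewrite -(Hb l).2 // !linearZ /= !scalerA mulrC.
  rewrite {1}(frame_sum (a i x) jx) linear_sum scaler_sumr (eq_bigr _ (fun l _ => T l)).
  move=> /(congr1 (fun w : 'rV[R]_n => w 0 i0)).
  rewrite /linefield summxE !mxE !eqxx mulr1 gi.
  under eq_bigr do rewrite !mxE !eqxx mulr1 mulrA.
  rewrite -mulr_suml => h; apply: (mulIf gk); rewrite -h; ring.
have keyp i k : phi p ^+ 2 * (i == k)%:R = \sum_l c i l p * b l (io k) p.
  apply/eqP; rewrite -subr_eq0; apply/eqP.
  pose f x := phi x ^+ 2 * (i == k)%:R - \sum_l c i l x * b l (io k) x.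
  apply: (@closure_eq0_at _ _ f _ oV jp (cl k)); last first.
    by move=> x jx gx; rewrite /f (key i k) // subrr.
  have cinf_f : Cinf (tdom j : set 'rV[R]_n) f.
    have sphi := Cinf_sub (@subsetT _ (tdom j : set 'rV[R]_n)) (Cc_Cinf cphi).
    have s1 : Cinf (tdom j : set 'rV[R]_n) (fun x => - \sum_l c i l x * b l (io k) x).
      have s2 : Cinf (tdom j : set 'rV[R]_n) (fun x => \sum_l c i l x * b l (io k) x).
        apply: Cinf_sum => // l _; apply: Cinf_M => //.
          by apply/smooth_onE; have [[+ _] _] := Ha i; apply.
        exact: Cinf_sub ((Hb l).1 (io k)).
      apply: (Cinf_ext oV _ (Cinf_M oV (Cinf_cst _ (-1)) s2)) => x _.
      by rewrite mulN1r.
    apply: Cinf_D => //; apply: Cinf_M => //; last exact: Cinf_cst.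
    exact: Cinf_M.
  exact: (Cinf_continuous cinf_f).
(* a factorization of an invertible m x m matrix through dimension trank j *)
pose C : 'M[R]_(m, trank j) := \matrix_(i, l) c i l p.
pose B : 'M[R]_(trank j, m) := \matrix_(l, k) b l (io k) p.
have CB : C *m B = (phi p ^+ 2) *: 1%:M.
  by apply/matrixP => i k; rewrite !mxE keyp; apply: eq_bigr => l _; rewrite !mxE.
have := mxrankM_maxl C B; rewrite CB mxrank_scale_nz ?mxrank1 ?sqrf_eq0 // => h.
exact: leq_trans h (rank_leq_col C).
Qed.

End RankBound.

(** * Sectors in the plane *)

Section Sectors.
Context {R : realType}.
Local Notation V := 'rV[R]_2.
Local Notation lev m := ((trunc_log 2 m)%:R : R).

(** Nonzero exactly for k < u < k + 1 and 2m (u - k) < v < (2m + 1) (u - k). The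
    slopes separate the sectors with the same apex, and the vertical strips
    separate those with distinct apices. *)
Definition sector (m : nat) (x : V) : R :=
  let k := lev m in let u := x 0 0 in let v := x 0 1 in
  theta 0 (u - k) * theta 0 (k + 1 - u)
  * theta 0 (v - m.*2%:R * (u - k)) * theta 0 (m.*2.+1%:R * (u - k) - v).

Lemma sector_smooth m : Cinf setT (sector m).
Proof.
have oT := @openT V; rewrite /sector.
have Th a b c (f : V -> R) : (forall x, f x = a * x 0 0 + b * x 0 1 + c) ->
    Cinf setT (fun x => theta 0 (f x)).
  by move=> E; apply: (Cinf_ext oT _ (Cinf_theta_affine 0 1 a b c)) => x _; rewrite E.
set k := lev m; apply: Cinf_M => //; first apply: Cinf_M => //; first apply: Cinf_M => //.
- by apply: (Th 1 0 (- k)) => x; ring.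
- by apply: (Th (-1) 0 (k + 1)) => x; ring.
- by apply: (Th (- m.*2%:R) 1 (m.*2%:R * k)) => x; ring.
- by apply: (Th (m.*2.+1%:R) (-1) (- (m.*2.+1%:R * k))) => x; ring.
Qed.

Lemma sector_neq0 m x : sector m x != 0 <->
  [/\ lev m < x 0 0, x 0 0 < lev m + 1, m.*2%:R * (x 0 0 - lev m) < x 0 1
    & x 0 1 < m.*2.+1%:R * (x 0 0 - lev m)].
Proof.
have tP (t : R) : (theta 0 t != 0) = (0 < t).
  by have [t0|t0] := ltP 0 t; [rewrite gt_eqF // theta_gt0 | rewrite theta_le0 ?eqxx].
rewrite /sector !mulf_eq0 !negb_or !tP !subr_gt0; split; last by case=> -> -> -> ->.
by move=> /andP[/andP[/andP[]]].
Qed.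

Lemma sector_disj (m k : nat) x : m != k -> sector m x * sector k x = 0.
Proof.
move=> mk; apply/eqP; rewrite mulf_eq0; apply: contraT; rewrite negb_or => /andP[].
wlog lt_mk : m k mk / (m < k)%N.
  move=> H sm sk; have [mk'|mk'] := ltnP m k; first exact: (H m k).
  by apply: (H k m) => //; [rewrite eq_sym | rewrite ltn_neqAle eq_sym mk].
move=> /sector_neq0[m1 m2 _ m4] /sector_neq0[k1 k2 k3 _].
have lev_eq : trunc_log 2 m = trunc_log 2 k.
  apply/eqP; rewrite eqn_leq -(ltnS _ (trunc_log 2 k)) -(ltnS _ (trunc_log 2 m)).
  by rewrite -!(ltr_nat R) -!natr1; apply/andP; split; lra.
rewrite -lev_eq in k1 k2 k3.
have : m.*2.+1%:R <= k.*2%:R :> R by rewrite ler_nat ltn_double.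
set t := x 0 0 - lev m in m4 k3; have t0 : 0 < t by rewrite subr_gt0.
by move=> h; have := ler_wpM2r (ltW t0) h; lra.
Qed.

(** A sector that meets u < K has its apex at some k < K, hence m < 2 ^ (k + 1)
    is bounded. *)
Lemma sector_fin (K : R) : exists N : nat, forall m (x : V),
  (N <= m)%N -> `|x| < K -> sector m x = 0.
Proof.
pose B := Num.bound `|K|; exists (2 ^ B)%N => m x Bm xK; apply/eqP.
apply: contraT => /sector_neq0[h _ _ _].
have KB : K < B%:R.
  by apply: le_lt_trans (ler_norm K) _; exact: archi_boundP (normr_ge0 K).
have Bl : (B <= trunc_log 2 m)%N by exact: trunc_log_max.
have : B%:R <= lev m by rewrite ler_nat.
have : x 0 0 < K.
  have : ball (0 : V) K x by rewrite mx_norm_ball /ball_ /= sub0r normrN.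
  move=> [_ /(_ 0 0)]; rewrite /ball /= mxE sub0r normrN.
  by apply: le_lt_trans; exact: ler_norm.
lra.
Qed.

Definition apex (k : nat) : V := \row_i (if i == 0 then k%:R else 0).

(** The apex is approached along the ray in the middle of the sector. *)
Lemma sector_apex m : closure [set x | sector m x != 0] (apex (trunc_log 2 m)).
Proof.
set p := apex _; move=> B nB.
pose w : V := \row_i (if i == 0 then 1 else m.*2%:R + 2^-1).
pose ga (t : R) : V := p + t *: w.
have cga : {for 0, continuous ga}.
  by apply: cvgD; [exact: cvg_cst | apply: cvgZr_tmp; exact: cvg_id].
have nga : nbhs (0 : R) (ga @^-1` B).
  by apply: cga; rewrite /ga scale0r addr0.
have /nbhs_ballP[e /= e0 He] := nga.
pose t := Num.min (e / 2) (2^-1).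
have t0 : 0 < t by rewrite lt_min divr_gt0 //= invr_gt0.
have te : t < e by rewrite gt_min ltr_pdivrMr // ltr_pMr // ltr1n.
have t1 : t < 1 by rewrite gt_min (invf_lt1 (ltr0n _ 2)) ltr1n orbT.
exists (ga t); split; last by apply: He; rewrite /ball /= sub0r normrN gtr0_norm.
apply/sector_neq0; rewrite /ga !mxE /= -(natr1 m.*2); split; nra.
Qed.

Lemma trunc_log_fiber k (i : 'I_(2 ^ k)) : trunc_log 2 (2 ^ k + i) = k.
Proof.
by apply: trunc_log_eq => //; rewrite leq_addr expnS mul2n -addnn ltn_add2l ltn_ord.
Qed.
End Sectors.

Theorem lemma1p3 (R : realType) :
  exists (M : manifold R) (F : set (vfield M)),
    singular_foliation F /\
    ~ exists A : lie_algebroid M, F = induced_foliation A.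
Proof.
exists (@euclid R 2), (linefol 0 sector); split.
  exact: linefol_singular sector_smooth sector_disj sector_fin.
move=> [A FA].
have [j0 j0P] := tdom_cover A (0 : 'rV[R]_2); pose k := trank j0.
have [j jP] := tdom_cover A (apex k : 'rV[R]_2).
(* the 2 ^ k sectors numbered 2 ^ k, ..., 2 ^ (k + 1) - 1 have apex (k, 0) *)
have := @rank_bound R 2 0 sector sector_disj A j (apex k) (2 ^ k)
  (fun i => 2 ^ k + i)%N FA jP.
rewrite (trank_const jP j0P) leqNgt ltn_expl // => H.
suff : false by []; apply: H.
- by move=> i i' /addnI /val_inj.
- by move=> i; have := @sector_apex R (2 ^ k + i); rewrite trunc_log_fiber; apply.
Qed.
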